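(* Let $a=(a_k)_{k\ge1}$ be a sequence of complex numbers with $a_1=0$. Then for every strict partition $\mu$, $$P_{\mu;a}\Bigl(P_{(1)}-\sum_{j=1}^{\ell(\mu)}a_{\mu_j+1}\Bigr)=\sum_{\lambda:\ \mu\nearrow\lambda}P_{\lambda;a}$$ in the algebra $\Gamma$.
   Context: $\Gamma$ is the algebra of supersymmetric functions: sequences $(f_m)_{m\ge1}$ of supersymmetric polynomials (symmetric, and independent of $t$ after substituting $x_i=t,x_j=-t$) with $f_{m+1}(x_1,\dots,x_m,0)=f_m$ and bounded degrees. Strict partitions are $\mu=(\mu_1>\dots>\mu_l>0)$, $\ell(\mu)=l$, $|\mu|=\sum\mu_i$. Put $(x\mid a)^k=\prod_{m=1}^k(x-a_m)$. For $\ell(\mu)=l\le m$, $$P_{\mu;a}(x_1,\dots,x_m)=\frac1{(m-l)!}\sum_{\omega\in S(m)}\prod_{i=1}^l (x_{\omega(i)}\mid a)^{\mu_i}\prod_{1\le i\le l,\ i<j\le m}\frac{x_{\omega(i)}+x_{\omega(j)}}{x_{\omega(i)}-x_{\omega(j)}},$$ and $0$ if $\ell(\mu)>m$; this defines $P_{\mu;a}\in\Gamma$. $P_{(1)}=\sum_j x_j$. For strict partitions $\mu,\lambda$, $\mu\nearrow\lambda$ means $|\lambda|=|\mu|+1$ and $\mu\subset\lambda$ (i.e. $\ell(\mu)\le\ell(\lambda)$ and $\mu_i\le\lambda_i$ for $i\le\ell(\mu)$). *)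

(* Defs.v *)
From HB Require Import structures.
From mathcomp Require Import all_boot all_order all_algebra all_fingroup.
From mathcomp Require Import zify boolp reals complex mpoly.

Set Implicit Arguments.
Unset Strict Implicit.
Unset Printing Implicit Defensive.

Import GRing.Theory Num.Theory.
Local Open Scope ring_scope.

(* (x | a)^k *)
Definition shifted_pow (R : comNzRingType) (a : nat -> R) (x : R) (k : nat) : R :=
  \prod_(1 <= r < k.+1) (x - a r).

(* Positions are 0-based: the i-th part (i < size mu) is nth 0 mu i. *)
Definition facP_frac (F : fieldType) (a : nat -> F) (mu : seq nat)
    (m : nat) (x : 'I_m -> F) : F :=
  if (size mu <= m)%N then
    ((m - size mu)`!%:R)^-1 *
    \sum_(w : 'S_m)
      (\prod_(i < m | (i < size mu)%N) shifted_pow a (x (w i)) (nth 0%N mu i) *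
       \prod_(i < m | (i < size mu)%N) \prod_(j < m | (i < j)%N)
         ((x (w i) + x (w j)) / (x (w i) - x (w j))))
  else 0.

Section Numerator.
Variables (R : comNzRingType) (m : nat).
Implicit Types (x : 'I_m -> R) (a : nat -> R) (mu : seq nat).

Definition vdm x : R := \prod_(i < m) \prod_(j < m | (i < j)%N) (x i - x j).

Lemma vdm_perm x (w : 'S_m) : vdm (fun i => x (w i)) = (-1) ^+ w * vdm x.
Proof.
have E y : vdm y = \det (Vandermonde m (\row_i - y i)).
  rewrite det_Vandermonde; apply: eq_bigr => i _; apply: eq_bigr => j _.
  by rewrite !mxE opprK addrC.
rewrite !E.
have -> : Vandermonde m (\row_i - x (w i)) = col_perm w (Vandermonde m (\row_i - x i)).
  by apply/matrixP => i j; rewrite !mxE.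
by rewrite col_permE det_mulmx det_perm odd_permV mulrC.
Qed.

Definition facP_num a mu x : R :=
  \sum_(w : 'S_m) (-1) ^+ w *
    (\prod_(i < m | (i < size mu)%N) shifted_pow a (x (w i)) (nth 0%N mu i) *
     \prod_(i < m | (i < size mu)%N) \prod_(j < m | (i < j)%N) (x (w i) + x (w j)) *
     \prod_(i < m | ~~ (i < size mu)%N) \prod_(j < m | (i < j)%N) (x (w i) - x (w j))).

Lemma facP_num_perm a mu x (s : 'S_m) :
  facP_num a mu (fun i => x (s i)) = (-1) ^+ s * facP_num a mu x.
Proof.
rewrite /facP_num mulr_sumr (reindex_inj (mulIg (s^-1)%g)) /=.
apply: eq_bigr => w _; rewrite mulrA; congr (_ * _).
  by rewrite odd_permM odd_permV -signr_addb addbC.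
have E i : s ((w * s^-1)%g i) = w i by rewrite permM permKV.
congr (_ * _ * _).
- by apply: eq_bigr => i _; rewrite E.
- by apply: eq_bigr => i _; apply: eq_bigr => j _; rewrite !E.
- by apply: eq_bigr => i _; apply: eq_bigr => j _; rewrite !E.
Qed.

End Numerator.

Lemma rmorph_shifted_pow (R S : comNzRingType) (f : {rmorphism R -> S}) a x k :
  f (shifted_pow a x k) = shifted_pow (fun r => f (a r)) (f x) k.
Proof. by rewrite rmorph_prod; apply: eq_bigr => r _; rewrite rmorphB. Qed.

Lemma rmorph_vdm (R S : comNzRingType) (f : {rmorphism R -> S}) m (x : 'I_m -> R) :
  f (vdm x) = vdm (fun i => f (x i)).
Proof.
rewrite rmorph_prod; apply: eq_bigr => i _; rewrite rmorph_prod.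
by apply: eq_bigr => j _; rewrite rmorphB.
Qed.

Lemma rmorph_facP_num (R S : comNzRingType) (f : {rmorphism R -> S}) a mu m
    (x : 'I_m -> R) :
  f (facP_num a mu x) = facP_num (fun r => f (a r)) mu (fun i => f (x i)).
Proof.
rewrite rmorph_sum; apply: eq_bigr => w _.
rewrite rmorphM rmorph_sign !rmorphM !rmorph_prod; congr (_ * (_ * _ * _)).
- by apply: eq_bigr => i _; rewrite rmorph_shifted_pow.
- apply: eq_bigr => i _; rewrite rmorph_prod.
  by apply: eq_bigr => j _; rewrite rmorphD.
- apply: eq_bigr => i _; rewrite rmorph_prod.
  by apply: eq_bigr => j _; rewrite rmorphB.
Qed.

Lemma vdm_neq0 (R : idomainType) m (x : 'I_m -> R) : injective x -> vdm x != 0.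
Proof.
move=> xI; apply/prodf_neq0 => i _; apply/prodf_neq0 => j ij.
by rewrite subr_eq0; apply: contraTneq ij => /xI ->; rewrite ltnn.
Qed.

Lemma facP_frac_vdm (F : fieldType) (a : nat -> F) mu m (x : 'I_m -> F) :
  (size mu <= m)%N -> injective x ->
  facP_frac a mu x * vdm x = ((m - size mu)`!%:R)^-1 * facP_num a mu x.
Proof.
move=> lm xI; rewrite /facP_frac lm -mulrA; congr (_ * _).
rewrite mulr_suml; apply: eq_bigr => w _.
have -> : vdm x = (-1) ^+ w * vdm (fun i => x (w i)).
  by rewrite vdm_perm mulrA -expr2 sqrr_sign mul1r.
rewrite [vdm _](bigID (fun i : 'I_m => (i < size mu)%N)) /=.
set S := \prod_(_ < m | _) shifted_pow _ _ _.
set D1 := \prod_(i < m | (i < size mu)%N) \prod_(j < m | (i < j)%N) (x (w i) - x (w j)).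
set D2 := \prod_(i < m | ~~ (i < size mu)%N) _.
set N := \prod_(i < m | (i < size mu)%N) \prod_(j < m | (i < j)%N) (x (w i) + x (w j)).
have -> : \prod_(i < m | (i < size mu)%N) \prod_(j < m | (i < j)%N)
           ((x (w i) + x (w j)) / (x (w i) - x (w j))) = N / D1.
  rewrite /N /D1 -prodf_div; apply: eq_bigr => i _; exact: prodf_div.
have D1n0 : D1 != 0.
  apply/prodf_neq0 => i _; apply/prodf_neq0 => j ij.
  by rewrite subr_eq0; apply: contraTneq ij => /xI/perm_inj ->; rewrite ltnn.
rewrite mulrCA; congr (_ * _); rewrite -!mulrA; congr (_ * (_ * _)).
by rewrite mulrA mulVf ?mul1r.
Qed.

Lemma facP_frac_perm (F : fieldType) (a : nat -> F) mu m (x : 'I_m -> F) (s : 'S_m) :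
  facP_frac a mu (fun i => x (s i)) = facP_frac a mu x.
Proof.
rewrite /facP_frac; case: ifP => // _; congr (_ * _).
rewrite (reindex_inj (mulIg (s^-1)%g)) /=; apply: eq_bigr => w _.
have E i : s ((w * s^-1)%g i) = w i by rewrite permM permKV.
congr (_ * _); first by apply: eq_bigr => i _; rewrite E.
by apply: eq_bigr => i _; apply: eq_bigr => j _; rewrite !E.
Qed.

Lemma rmorph_mmap n (R S T : comNzRingType) (h : {rmorphism S -> T})
    (f : {rmorphism R -> S}) (g : 'I_n -> S) (p : {mpoly R[n]}) :
  h (mmap f g p) = mmap (h \o f) (fun i => h (g i)) p.
Proof.
rewrite /mmap rmorph_sum; apply: eq_bigr => u _ /=.
rewrite rmorphM /mmap1 rmorph_prod; congr (_ * _).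
by apply: eq_bigr => i _; rewrite rmorphXn.
Qed.

Lemma mpolyXI (R : nzRingType) m (i j : 'I_m) :
  'X_i = 'X_j :> {mpoly R[m]} -> i = j.
Proof.
move/(congr1 (mcoeff U_(j))); rewrite !mcoeffXU eqxx.
by case: eqP => // _ /esym/eqP; rewrite oner_eq0.
Qed.

Section Antisymmetric.
Variables (C : idomainType) (m : nat).
Implicit Types (p q : {mpoly C[m]}) (i j : 'I_m).

Local Notation ident_var i j :=
  (mmap (@mpolyC m C) (fun k : 'I_m => 'X_(if k == i then j else k))).

Lemma ident_varX i j k : ident_var i j 'X_k = 'X_(if k == i then j else k).
Proof. by rewrite mmapX mmap1U. Qed.

Lemma ident_var_sub i j p : exists q, p - ident_var i j p = q * ('X_i - 'X_j).
Proof.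
pose P p := exists q, p - ident_var i j p = q * ('X_i - 'X_j).
have PM p1 p2 : P p1 -> P p2 -> P (p1 * p2).
  move=> [q1 e1] [q2 e2]; exists (q1 * p2 + ident_var i j p1 * q2).
  rewrite rmorphM mulrDl -[X in _ = _ + X]mulrA -e2 (mulrAC q1) -e1 mulrBl mulrBr.
  by rewrite addrA subrK.
have P1 : P 1 by exists 0; rewrite rmorph1 subrr mul0r.
have PX k : P 'X_k.
  rewrite /P ident_varX; case: eqP => [->|_]; first by exists 1; rewrite mul1r.
  by exists 0; rewrite subrr mul0r.
elim/mpolyind: p => [|c u p _ _ [q e]]; first by exists 0; rewrite rmorph0 subrr mul0r.
have [r er] : P 'X_[u].
  rewrite mpolyXE_id; elim/big_ind: _ => // k _.
  by elim: (u k) => [|d IH]; [rewrite expr0|rewrite exprS; apply: PM].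
exists (c *: r + q); rewrite rmorphD -mul_mpolyC rmorphM /= mmapC mulrDl -e.
by rewrite -mul_mpolyC -mulrA -er mulrBr opprD addrACA.
Qed.

Lemma dvd_pairs (N : {mpoly C[m]}) (r : seq ('I_m * 'I_m)) :
  uniq r -> (forall ij, ij \in r -> (ij.1 < ij.2)%N /\ ident_var ij.1 ij.2 N = 0) ->
  exists q, N = q * \prod_(ij <- r) ('X_(ij.1) - 'X_(ij.2)).
Proof.
elim: r => [|[k l] r IH] /=; first by exists N; rewrite big_nil mulr1.
case/andP => klr ur H.
have [|q eq] := IH ur; first by move=> ij ijr; apply: H; rewrite inE ijr orbT.
have [kl Nkl] := H (k, l) (mem_head _ _).
have /eqP : ident_var k l q * ident_var k l (\prod_(ij <- r) ('X_(ij.1) - 'X_(ij.2))) = 0.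
  by rewrite -rmorphM -eq.
rewrite mulf_eq0 => /orP[/eqP q0|].
  have [q' eq'] := ident_var_sub k l q.
  exists q'; rewrite big_cons mulrA /= -eq' q0 subr0.
  exact: eq.
rewrite rmorph_prod /= prodf_seq_eq0 => /hasP[[i j] ijr /=].
have [/= ij _] : ((i, j).1 < (i, j).2)%N /\ _ := H (i, j) (mem_behead (s := (k, l) :: r) ijr).
rewrite rmorphB /= !ident_varX subr_eq0 => /eqP/mpolyXI.
have kl' : (k < l)%N := kl; move: klr ij kl' ijr.
case: (i =P k) => [->|_]; case: (j =P k) => [->|_].
- by rewrite ltnn.
- by move=> klr _ _ ijr e; rewrite e ijr in klr.
- by move=> _ lk kl' _ e; rewrite e ltnNge ltnW in lk.
- by move=> _ ij _ _ e; rewrite e ltnn in ij.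
Qed.

End Antisymmetric.

Lemma facP_num_eq0 (R : idomainType) (a : nat -> R) mu m (x : 'I_m -> R) i j :
  2%:R != 0 :> R -> i != j -> x i = x j -> facP_num a mu x = 0.
Proof.
move=> n2 ij xij; have := facP_num_perm a mu x (tperm i j).
have -> : (fun k => x (tperm i j k)) = x.
  by apply/funext => k; case: tpermP => [->|->|].
rewrite odd_tperm ij expr1 mulN1r => /eqP; rewrite -subr_eq0 opprK -mulr2n.
by rewrite -mulr_natr mulf_eq0 (negbTE n2) orbF => /eqP.
Qed.

Section FactorialP.
Variable C : numFieldType.
Implicit Types (a : nat -> C) (mu : seq nat) (m : nat).

Definition facP_rat a mu m : {fraction {mpoly C[m]}} :=
  facP_frac (fun r => FracField.tofrac (a r)%:MP_[m]) mu
            (fun i : 'I_m => FracField.tofrac 'X_i).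

Lemma vdm_pairs m : vdm (fun i : 'I_m => 'X_i : {mpoly C[m]}) =
  \prod_(ij <- enum [pred ij : 'I_m * 'I_m | (ij.1 < ij.2)%N]) ('X_(ij.1) - 'X_(ij.2)).
Proof. by rewrite /vdm pair_big_dep big_enum. Qed.

Lemma facP_num_vdm a mu m : exists q : {mpoly C[m]},
  facP_num (fun r => (a r)%:MP_[m]) mu (fun i : 'I_m => 'X_i) =
  q * vdm (fun i : 'I_m => 'X_i).
Proof.
rewrite vdm_pairs; apply: dvd_pairs; first exact: enum_uniq.
move=> [i j]; rewrite mem_enum inE /= => ij; split=> //.
rewrite rmorph_facP_num; apply: (@facP_num_eq0 _ _ _ _ _ i j).
- by rewrite -mpolyC_nat mpolyC_eq0 pnatr_eq0.
- by rewrite -val_eqE /= ltn_eqF.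
- by rewrite /= !ident_varX eqxx; case: ifP.
Qed.

Lemma tofrac_inv_nat m (n : nat) :
  FracField.tofrac ((n%:R^-1 : C)%:MP_[m]) = (n%:R)^-1.
Proof.
have /= -> := fmorphV (@FracField.tofrac {mpoly C[m]} \o @mpolyC m C) n%:R.
by rewrite -[LHS]/((_ \o _) _)^-1 rmorph_nat.
Qed.

Lemma facP_rat_poly a mu m : exists p : {mpoly C[m]}, FracField.tofrac p = facP_rat a mu m.
Proof.
case: (leqP (size mu) m) => lm; last first.
  by exists 0; rewrite rmorph0 /facP_rat /facP_frac leqNgt lm.
have [q e] := facP_num_vdm a mu m.
have XI : injective (fun i : 'I_m => FracField.tofrac ('X_i : {mpoly C[m]})).
  by move=> i j /eqP; rewrite tofrac_eq => /eqP/mpolyXI.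
exists ((((m - size mu)`!%:R)^-1)%:MP * q).
apply: (mulIf (vdm_neq0 XI)); rewrite facP_frac_vdm //.
rewrite -(rmorph_facP_num (@FracField.tofrac _)) e -rmorph_vdm !rmorphM mulrA.
by rewrite /= tofrac_inv_nat.
Qed.

(* The unique polynomial equal to the rational function facP_rat a mu m. *)
Definition facP_poly a mu m : {mpoly C[m]} := projT1 (cid (facP_rat_poly a mu m)).

Lemma facP_polyE a mu m : FracField.tofrac (facP_poly a mu m) = facP_rat a mu m.
Proof. exact: projT2 (cid (facP_rat_poly a mu m)). Qed.

Lemma facP_poly_vdm a mu m : (size mu <= m)%N ->
  facP_poly a mu m * vdm (fun i : 'I_m => 'X_i) =
  (((m - size mu)`!%:R)^-1)%:MP * facP_num (fun r => (a r)%:MP_[m]) mu (fun i : 'I_m => 'X_i).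
Proof.
move=> lm; apply/eqP; rewrite -tofrac_eq; apply/eqP.
have XI : injective (fun i : 'I_m => FracField.tofrac ('X_i : {mpoly C[m]})).
  by move=> i j /eqP; rewrite tofrac_eq => /eqP/mpolyXI.
rewrite !rmorphM /= facP_polyE rmorph_vdm rmorph_facP_num facP_frac_vdm //.
by rewrite tofrac_inv_nat.
Qed.

Lemma facP_poly0 a mu m : (m < size mu)%N -> facP_poly a mu m = 0.
Proof.
move=> lm; apply/eqP; rewrite -tofrac_eq0 facP_polyE.
by rewrite /facP_rat /facP_frac leqNgt lm.
Qed.

Lemma facP_poly_spec (K : fieldType) (f : {rmorphism C -> K}) a mu m (x : 'I_m -> K) :
  injective x -> mmap f x (facP_poly a mu m) = facP_frac (fun r => f (a r)) mu x.
Proof.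
move=> xI; case: (leqP (size mu) m) => lm; last first.
  by rewrite facP_poly0 // rmorph0 /facP_frac leqNgt lm.
apply: (mulIf (vdm_neq0 xI)); rewrite facP_frac_vdm //.
have vX : (fun i => mmap f x 'X_i) = x.
  by apply/funext => i; rewrite mmapX mmap1U.
have -> : vdm x = mmap f x (vdm (fun i : 'I_m => 'X_i)) by rewrite rmorph_vdm /= vX.
rewrite -rmorphM facP_poly_vdm // rmorphM rmorph_facP_num /= vX mmapC /= fmorphV rmorph_nat.
congr (_ * facP_num _ _ _); apply/funext => r; exact: mmapC.
Qed.

Lemma facP_poly_sym a mu m : facP_poly a mu m \is symmetric.
Proof.
apply/issymP => s; apply/eqP; rewrite -tofrac_eq /msym rmorph_mmap /= facP_polyE.
rewrite facP_poly_spec; first by apply/eqP/(facP_frac_perm _ _ (fun i => FracField.tofrac 'X_i)).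
by move=> i j /eqP; rewrite tofrac_eq => /eqP/mpolyXI/perm_inj.
Qed.

End FactorialP.
Section Stability.
Variables (F : fieldType) (a : nat -> F) (mu : seq nat).

Lemma big_lift m (r : 'I_m.+1) (P : pred 'I_m.+1) (G : 'I_m.+1 -> F) :
  \prod_(i | P i) G i =
  (if P r then G r else 1) * \prod_(k | P (lift r k)) G (lift r k).
Proof. by rewrite big_mkcond (bigD1_ord r) //= -big_mkcond. Qed.

Lemma reindex_lift_perm m (r s : 'I_m.+1) (G : 'S_m.+1 -> F) :
  \sum_(w : 'S_m.+1 | w r == s) G w = \sum_(w : 'S_m) G (lift_perm r s w).
Proof.
rewrite (reindex (lift_perm r s)); last first.
  pose ulsf i (s : 'S_m.+1) k := odflt k (unlift (s i) (s (lift i k))).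
  have ulsfK i (s' : 'S_m.+1) k: lift (s' i) (ulsf i s' k) = s' (lift i k).
    rewrite /ulsf; have:= neq_lift i k.
    by rewrite -(can_eq (permK s')) => /unlift_some[] ? ? ->.
  have inj_ulsf: injective (ulsf r _).
    move=> s'; apply: can_inj (ulsf (s' r) s'^-1%g) _ => k'.
    by rewrite {1}/ulsf ulsfK !permK liftK.
  exists (fun s => perm (inj_ulsf s)) => [s' _ | s'].
    by apply/permP=> k'; rewrite permE /ulsf lift_perm_lift lift_perm_id liftK.
  move/(s' r =P _) => si0; apply/permP=> k.
  case: (unliftP r k) => [k'|] ->; rewrite ?lift_perm_id //.
  by rewrite lift_perm_lift -si0 permE ulsfK.
by apply: eq_bigl => w; rewrite lift_perm_id eqxx.
Qed.

Lemma facP_frac_stable m (x : 'I_m -> F) :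
  (forall n, n.+1%:R != 0 :> F) -> a 1%N = 0 -> 0%N \notin mu -> (forall i, x i != 0) ->
  facP_frac a mu (fun i : 'I_m.+1 => if unlift ord_max i is Some k then x k else 0) =
  facP_frac a mu x.
Proof.
move=> char0 a1 mu0 x0; set y := fun i : 'I_m.+1 => _.
have y0 : y ord_max = 0 by rewrite /y unlift_none.
have yl k : y (lift ord_max k) = x k by rewrite /y liftK.
rewrite /facP_frac; case: (ltngtP (size mu) m.+1) => [lm|lm|lm]; last 2 first.
- by rewrite ifN // -ltnNge ltnW.
- rewrite ifN -?ltnNge ?lm // big1 ?mulr0 // => w _.
  apply/eqP; rewrite mulf_eq0; apply/orP; left; apply/prodf_eq0.
  exists ((w^-1)%g ord_max); first by rewrite ?lm /=.
  rewrite permKV y0; set i := (w^-1)%g _.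
  have : (0 < nth 0%N mu i)%N.
    by rewrite lt0n; apply: contraNneq mu0 => <-; rewrite mem_nth ?lm /=.
  by case: (nth _ _ _) => // d _; rewrite /shifted_pow big_ltn // a1 subrr mul0r.
rewrite ltnS in lm; rewrite lm.
rewrite (partition_big (fun w : 'S_m.+1 => (w^-1)%g ord_max) xpredT) //=.
set S := \sum_(w : 'S_m) _.
have part (r : 'I_m.+1) : \sum_(w : 'S_m.+1 | (w^-1)%g ord_max == r)
   (\prod_(i < m.+1 | (i < size mu)%N) shifted_pow a (y (w i)) (nth 0%N mu i) *
    \prod_(i < m.+1 | (i < size mu)%N) \prod_(j < m.+1 | (i < j)%N)
      ((y (w i) + y (w j)) / (y (w i) - y (w j)))) = if (size mu <= r)%N then S else 0.
  case: leqP => [lr|rl]; last first.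
    rewrite big1 // => w /eqP wr; apply/eqP; rewrite mulf_eq0; apply/orP; left.
    apply/prodf_eq0; exists r => //; rewrite -wr permKV y0 wr.
    have : (0 < nth 0%N mu r)%N.
      by rewrite lt0n; apply: contraNneq mu0 => <-; rewrite mem_nth.
    by case: (nth _ _ _) => // d _; rewrite /shifted_pow big_ltn // a1 subrr mul0r.
  under eq_bigl => w do rewrite (canF_eq (permKV w)) eq_sym.
  rewrite reindex_lift_perm; apply: eq_bigr => w _.
  have liftlt (k : 'I_m) : (lift r k < size mu)%N = (k < size mu)%N.
    rewrite /= /bump; case: (leqP r k) => //= rk; rewrite add1n.
    by rewrite !ltnNge (leq_trans lr rk) (leq_trans lr (leq_trans rk (leqnSn _))).
  have yw k : y (lift_perm r ord_max w (lift r k)) = x (w k) by rewrite lift_perm_lift.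
  have yr : y (lift_perm r ord_max w r) = 0 by rewrite lift_perm_id.
  congr (_ * _).
    rewrite (big_lift r) ltnNge lr mul1r; apply: eq_big => k; first exact: liftlt.
    rewrite yw /= /bump => kl; rewrite leqNgt (leq_trans _ lr) //.
    by rewrite -liftlt.
  rewrite (big_lift r) ltnNge lr mul1r; apply: eq_big => k; first exact: liftlt.
  rewrite liftlt => kl; rewrite (big_lift r) yw yr addr0 subr0 divff ?x0 // if_same mul1r.
  apply: eq_big => k'; first by rewrite /= !ltnNge leq_bump2.
  by rewrite !yw.
rewrite (eq_bigr _ (fun r _ => part r)) -big_mkcond /= sumr_const.
have -> : #|[pred r : 'I_m.+1 | (size mu <= r)%N]| = (m.+1 - size mu)%N.
  by rewrite -sum1_card -(big_geq_mkord _ _ xpredT (fun=> 1%N)) sum_nat_const_nat muln1.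
rewrite subSn // factS natrM invfM -mulrA -[S *+ _]mulr_natl.
by rewrite (mulrCA _ _ S) !mulrA mulVf // mul1r.
Qed.

End Stability.

Lemma facP_frac_super (F : fieldType) (a : nat -> F) mu m (x y : 'I_m -> F) i j :
  i != j -> x j = - x i -> y j = - y i ->
  (forall k, k != i -> k != j -> [/\ x k = y k, x k != x i, x k != - x i,
                                    y k != y i & y k != - y i]) ->
  facP_frac a mu x = facP_frac a mu y.
Proof.
move=> ij xj yj E; rewrite /facP_frac; case: ifP => // lm; congr (_ * _).
apply: eq_bigr => w _.
pose p := (w^-1)%g i; pose q := (w^-1)%g j.
have wp : w p = i by rewrite permKV.
have wq : w q = j by rewrite permKV.
have pq : p != q by rewrite (inj_eq perm_inj).
have [pqlt|/norP[pl ql]] := boolP ((p < size mu) || (q < size mu))%N.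
  have Z (z : 'I_m -> F) : z j = - z i ->
     \prod_(k < m | (k < size mu)%N) \prod_(k' < m | (k < k')%N)
         ((z (w k) + z (w k')) / (z (w k) - z (w k'))) = 0.
    move=> zj; apply/eqP/prodf_eq0.
    case: (ltngtP p q) => [lt|lt|/val_inj e]; last by rewrite e eqxx in pq.
      exists p; first by case/orP: pqlt => // ?; apply: ltn_trans lt _.
      by apply/prodf_eq0; exists q => //; rewrite wp wq zj subrr mul0r.
    exists q; first by case/orP: pqlt => // ?; apply: ltn_trans lt _.
    by apply/prodf_eq0; exists p => //; rewrite wp wq zj addNr mul0r.
  by rewrite !Z // !mulr0.
have ne (k : 'I_m) : k != p -> k != q -> (w k != i) && (w k != j).
  by move=> kp kq; rewrite -wp -wq !(inj_eq perm_inj) kp.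
have nel (k : 'I_m) : (k < size mu)%N -> (w k != i) && (w k != j).
  by move=> kl; apply: ne; [apply: contraNneq pl|apply: contraNneq ql] => <-.
congr (_ * _); apply: eq_bigr => k kl; case/andP: (nel k kl) => ki kj.
  by have [-> _ _ _ _] := E _ ki kj.
have [kxy x1 x2 y1 y2] := E _ ki kj.
have kp : (k < p)%N by rewrite (leq_trans kl) // leqNgt.
have kq : (k < q)%N by rewrite (leq_trans kl) // leqNgt.
have qp : q != p by rewrite eq_sym.
have kqp : (k < q)%N && (q != p) by rewrite kq qp.
rewrite (bigD1 p) //= (bigD1 q kqp) /=.
rewrite [RHS](bigD1 p) //= [X in _ = _ * X](bigD1 q kqp) /= !mulrA wp wq xj yj !opprK.
congr (_ * _); last first.
  apply: eq_bigr => k' /andP[/andP[_ k'p] k'q]; case/andP: (ne k' k'p k'q) => k'i k'j.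
  by rewrite kxy; have [-> _ _ _ _] := E _ k'i k'j.
have one (u t : F) : u != t -> u != - t -> (u + t) / (u - t) * (u - t) / (u + t) = 1.
  move=> ut uNt; rewrite divfK ?subr_eq0 // divff //.
  by rewrite -[t]opprK subr_eq0.
by rewrite !one.
Qed.
Section StrictPartitions.

Definition is_strict (s : seq nat) : bool := sorted gtn s && (0%N \notin s).

Record strict_part := StrictPart { parts :> seq nat; partsP : is_strict parts }.

HB.instance Definition _ := [isSub for parts].
HB.instance Definition _ := [Countable of strict_part by <:].

Definition included (mu lam : strict_part) : bool :=
  (size mu <= size lam)%N &&
  [forall i : 'I_(size mu), (nth 0 mu i <= nth 0 lam i)%N].

(* mu -> lam, adding one box *)
Definition covers (mu lam : strict_part) : bool :=
  (sumn lam == (sumn mu).+1) && included mu lam.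

(* All strict partitions of n, see mem_strict_parts: a strict partition of n is a
   subsequence of n, n - 1, ..., 1. *)
Definition strict_parts (n : nat) : seq strict_part :=
  undup (pmap insub
    [seq s <- [seq mask b (rev (iota 1 n)) | b : n.-tuple bool] | sumn s == n]).

Lemma strict_parts_uniq n : uniq (strict_parts n).
Proof. exact: undup_uniq. Qed.

Lemma mem_strict_parts n (lam : strict_part) :
  (lam \in strict_parts n) = (sumn lam == n).
Proof.
rewrite mem_undup mem_pmap_sub mem_filter andbC.
have [/eqP sn|] := boolP (sumn lam == n); last by rewrite andbF.
rewrite andbT; case: lam sn => s /= /andP[so s0] sn.
have gt_tr : transitive gtn by move=> y x z; rewrite /= => h1 h2; apply: ltn_trans h2 h1.
have gt_irr : irreflexive gtn by move=> x; rewrite /= ltnn.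
have so_r : sorted gtn (rev (iota 1 n)) by rewrite rev_sorted iota_ltn_sorted.
have le_sum x : x \in s -> (x <= n)%N.
  by rewrite -sn; elim: (s) => //= y r IH; rewrite inE => /orP[/eqP->|/IH]; lia.
have e : s = [seq x <- rev (iota 1 n) | x \in s].
  apply: (irr_sorted_eq gt_tr gt_irr so); first exact: sorted_filter.
  move=> x; rewrite mem_filter mem_rev mem_iota; case xs : (x \in s) => //=.
  rewrite add1n ltnS le_sum // andbT lt0n; apply/esym.
  by apply: contraNneq s0 => <-.
have /subseqP[b sb eb] : subseq s (rev (iota 1 n)) by rewrite e filter_subseq.
rewrite size_rev size_iota in sb.
apply/mapP; exists (tcast sb (in_tuple b)); first by rewrite mem_enum.
by rewrite val_tcast.
Qed.

End StrictPartitions.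

Section Gamma.
Variable C : numFieldType.

(* x_i := t, x_j := - t *)
Definition subst_opp m (i j : 'I_m) (p : {mpoly C[m]}) : {poly {mpoly C[m]}} :=
  mmap (polyC \o @mpolyC m C)
       (fun k => if k == i then 'X else if k == j then - 'X else ('X_k)%:P) p.

Definition supersymmetric m (p : {mpoly C[m]}) : Prop :=
  p \is symmetric /\
  forall i j : 'I_m, i != j -> exists c : {mpoly C[m]}, subst_opp i j p = c%:P.

(* x_{m+1} := 0 *)
Definition last0 m : m.+1.-tuple {mpoly C[m]} :=
  [tuple if unlift ord_max i is Some k then 'X_k else 0 | i < m.+1].

(* Component m is the polynomial in m + 1 variables. *)
Record Gamma := MkGamma {
  gcomp :> forall m, {mpoly C[m.+1]};
  gcomp_super : forall m, supersymmetric (gcomp m);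
  gcomp_stable : forall m, gcomp m.+1 \mPo last0 m.+1 = gcomp m;
  gcomp_bounded : exists d, forall m, (msize (gcomp m) <= d)%N }.

HB.instance Definition _ := gen_eqMixin Gamma.
HB.instance Definition _ := gen_choiceMixin Gamma.

Lemma GammaP (f g : Gamma) : (forall m, f m = g m) -> f = g.
Proof.
move=> fg; case: f g fg => f f1 f2 f3 [g g1 g2 g3] /= fg.
have e : f = g by apply: functional_extensionality_dep.
by subst g; congr MkGamma; apply: Prop_irrelevance.
Qed.

Lemma superC m c : supersymmetric (c%:MP_[m]).
Proof.
split=> [|i j ij]; first by apply/issymP => s; rewrite /msym mmapC.
by exists c%:MP; rewrite /subst_opp mmapC.
Qed.

Lemma superD m (p q : {mpoly C[m]}) :
  supersymmetric p -> supersymmetric q -> supersymmetric (p + q).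
Proof.
move=> [p1 p2] [q1 q2]; split=> [|i j ij]; first exact: rpredD.
have [c ec] := p2 i j ij; have [d ed] := q2 i j ij.
by exists (c + d); rewrite /subst_opp rmorphD polyCD -ec -ed.
Qed.

Lemma superM m (p q : {mpoly C[m]}) :
  supersymmetric p -> supersymmetric q -> supersymmetric (p * q).
Proof.
move=> [p1 p2] [q1 q2]; split=> [|i j ij]; first exact: rpredM.
have [c ec] := p2 i j ij; have [d ed] := q2 i j ij.
by exists (c * d); rewrite /subst_opp rmorphM polyCM -ec -ed.
Qed.

Lemma msizeM_leq m (p q : {mpoly C[m]}) d e :
  (msize p <= d.+1)%N -> (msize q <= e.+1)%N -> (msize (p * q) <= (d + e).+1)%N.
Proof.
have [->|p0] := eqVneq p 0; first by rewrite mul0r msize0.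
have [->|q0] := eqVneq q 0; first by rewrite mulr0 msize0.
by move=> pd qd; rewrite msizeM // -subn1 leq_subLR; have := leq_add pd qd; rewrite addSn addnS add1n.
Qed.

Lemma msizeD_leq m (p q : {mpoly C[m]}) d :
  (msize p <= d)%N -> (msize q <= d)%N -> (msize (p + q) <= d)%N.
Proof. by move=> pd qd; apply: leq_trans (msizeD_le _ _) _; rewrite geq_max pd. Qed.

Lemma const_stable (c : C) m : c%:MP_[m.+2] \mPo last0 m.+1 = c%:MP.
Proof. exact: comp_mpolyC. Qed.

Lemma const_bounded (c : C) : exists d, forall m, (msize (c%:MP_[m.+1]) <= d)%N.
Proof. by exists 1%N => m; rewrite msizeC; case: eqP. Qed.

Definition gamma_const (c : C) : Gamma :=
  MkGamma (fun m => superC m.+1 c) (const_stable c) (const_bounded c).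

Lemma add_stable (f g : Gamma) m : (f m.+1 + g m.+1) \mPo last0 m.+1 = f m + g m.
Proof. by rewrite rmorphD /= !gcomp_stable. Qed.

Lemma add_bounded (f g : Gamma) : exists d, forall m, (msize (f m + g m) <= d)%N.
Proof.
have [d fd] := gcomp_bounded f; have [e ge] := gcomp_bounded g.
exists (d + e)%N => m; apply: msizeD_leq.
  by apply: leq_trans (fd m) _; rewrite leq_addr.
by apply: leq_trans (ge m) _; rewrite leq_addl.
Qed.

Definition gamma_add (f g : Gamma) : Gamma :=
  MkGamma (fun m => superD (gcomp_super f m) (gcomp_super g m))
          (add_stable f g) (add_bounded f g).

Lemma mul_stable (f g : Gamma) m : (f m.+1 * g m.+1) \mPo last0 m.+1 = f m * g m.
Proof. by rewrite rmorphM /= !gcomp_stable. Qed.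

Lemma mul_bounded (f g : Gamma) : exists d, forall m, (msize (f m * g m) <= d)%N.
Proof.
have [d fd] := gcomp_bounded f; have [e ge] := gcomp_bounded g.
by exists (d + e).+1 => m; apply: msizeM_leq; apply: leqW.
Qed.

Definition gamma_mul (f g : Gamma) : Gamma :=
  MkGamma (fun m => superM (gcomp_super f m) (gcomp_super g m))
          (mul_stable f g) (mul_bounded f g).

Definition gamma_scale (c : C) (f : Gamma) : Gamma := gamma_mul (gamma_const c) f.

Definition gamma_opp (f : Gamma) : Gamma := gamma_scale (-1) f.

Lemma gamma_addA : associative gamma_add.
Proof. by move=> f g h; apply: GammaP => m; apply: addrA. Qed.
Lemma gamma_addC : commutative gamma_add.
Proof. by move=> f g; apply: GammaP => m; apply: addrC. Qed.
Lemma gamma_add0 : left_id (gamma_const 0) gamma_add.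
Proof. by move=> f; apply: GammaP => m /=; rewrite mpolyC0 add0r. Qed.
Lemma gamma_addN : left_inverse (gamma_const 0) gamma_opp gamma_add.
Proof.
by move=> f; apply: GammaP => m /=; rewrite mpolyC0 mpolyCN mpolyC1 mulN1r addNr.
Qed.

HB.instance Definition _ :=
  GRing.isZmodule.Build Gamma gamma_addA gamma_addC gamma_add0 gamma_addN.

Lemma gamma_mulA : associative gamma_mul.
Proof. by move=> f g h; apply: GammaP => m; apply: mulrA. Qed.
Lemma gamma_mulC : commutative gamma_mul.
Proof. by move=> f g; apply: GammaP => m; apply: mulrC. Qed.
Lemma gamma_mul1 : left_id (gamma_const 1) gamma_mul.
Proof. by move=> f; apply: GammaP => m /=; rewrite mpolyC1 mul1r. Qed.
Lemma gamma_mulDl : left_distributive gamma_mul +%R.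
Proof. by move=> f g h; apply: GammaP => m; apply: mulrDl. Qed.
Lemma gamma_1neq0 : gamma_const 1 != 0.
Proof.
apply/eqP => /(congr1 (fun f : Gamma => f 0%N)) /eqP /=.
by rewrite mpolyC1 mpolyC0 oner_eq0.
Qed.

HB.instance Definition _ := GRing.Zmodule_isComNzRing.Build Gamma
  gamma_mulA gamma_mulC gamma_mul1 gamma_mulDl gamma_1neq0.

Lemma gamma_scaleA c d f : gamma_scale c (gamma_scale d f) = gamma_scale (c * d) f.
Proof. by apply: GammaP => m /=; rewrite mpolyCM mulrA. Qed.
Lemma gamma_scale1 : left_id 1 gamma_scale.
Proof. exact: gamma_mul1. Qed.
Lemma gamma_scaleDr : right_distributive gamma_scale +%R.
Proof. by move=> c f g; apply: GammaP => m /=; rewrite mulrDr. Qed.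
Lemma gamma_scaleDl f : {morph gamma_scale^~ f : c d / c + d}.
Proof. by move=> c d; apply: GammaP => m /=; rewrite mpolyCD mulrDl. Qed.

HB.instance Definition _ := GRing.Zmodule_isLmodule.Build C Gamma
  gamma_scaleA gamma_scale1 gamma_scaleDr gamma_scaleDl.

Lemma gamma_scaleAl (c : C) (f g : Gamma) : c *: (f * g) = (c *: f) * g.
Proof. by apply: GammaP => m; apply: mulrA. Qed.

HB.instance Definition _ := GRing.Lmodule_isLalgebra.Build C Gamma gamma_scaleAl.
HB.instance Definition _ := GRing.Lalgebra_isComAlgebra.Build C Gamma.

Lemma gammaD (f g : Gamma) m : (f + g) m = f m + g m. Proof. by []. Qed.
Lemma gammaM (f g : Gamma) m : (f * g) m = f m * g m. Proof. by []. Qed.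
Lemma gammaN (f : Gamma) m : (- f) m = - f m.
Proof. by rewrite /= mpolyCN mpolyC1 mulN1r. Qed.
Lemma gammaZ (c : C) (f : Gamma) m : (c *: f) m = c *: f m.
Proof. by rewrite /= mul_mpolyC. Qed.
Lemma gamma0 m : (0 : Gamma) m = 0. Proof. by rewrite /= mpolyC0. Qed.
Lemma gamma1 m : (1 : Gamma) m = 1. Proof. by rewrite /= mpolyC1. Qed.
Lemma gamma_sum I (r : seq I) (P : pred I) (F : I -> Gamma) m :
  (\sum_(i <- r | P i) F i) m = \sum_(i <- r | P i) F i m.
Proof. by apply: (big_morph (fun f : Gamma => f m)) => //; apply: gamma0. Qed.

Definition p1_poly m : {mpoly C[m]} := \sum_(i < m) 'X_i.

Lemma p1_super m : supersymmetric (p1_poly m).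
Proof.
split=> [|i j ij].
  apply/issymP => s; rewrite rmorph_sum [RHS](reindex_inj (@perm_inj _ s)) /=.
  by apply: eq_bigr => i _; rewrite /msym mmapX mmap1U.
exists (\sum_(k < m | (k != i) && (k != j)) 'X_k).
rewrite /subst_opp rmorph_sum /= (bigD1 i) //= (bigD1 j) 1?eq_sym //=.
rewrite !mmapX !mmap1U eqxx (negbTE (_ : j != i)) 1?eq_sym // eqxx addrA subrr add0r.
rewrite rmorph_sum /=; apply: eq_bigr => k /andP[ki kj].
by rewrite mmapX mmap1U (negbTE ki) (negbTE kj).
Qed.

Lemma p1_stable m : p1_poly m.+2 \mPo last0 m.+1 = p1_poly m.+1.
Proof.
rewrite rmorph_sum /= (bigD1_ord ord_max) //= comp_mpolyXU -tnth_nth tnth_mktuple.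
rewrite unlift_none add0r; apply: eq_bigr => i _.
by rewrite comp_mpolyXU -tnth_nth tnth_mktuple liftK.
Qed.

Lemma p1_bounded : exists d, forall m, (msize (p1_poly m.+1) <= d)%N.
Proof.
exists 2%N => m; rewrite /p1_poly; elim/big_ind: _ => [|p q|i _].
- by rewrite msize0.
- exact: msizeD_leq.
by rewrite msizeX mdeg1.
Qed.

(* P_(1) *)
Definition gamma_p1 : Gamma := MkGamma (fun m => p1_super m.+1) p1_stable p1_bounded.

End Gamma.

Section FactorialPGamma.
Variable C : numFieldType.
Implicit Types (a : nat -> C).

Lemma msize_prod_leq m I (r : seq I) (P : pred I) (d : I -> nat) (G : I -> {mpoly C[m]}) :
  (forall i, P i -> (msize (G i) <= (d i).+1)%N) ->
  (msize (\prod_(i <- r | P i) G i) <= (\sum_(i <- r | P i) d i).+1)%N.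
Proof.
move=> H; apply: (big_ind2 (fun (p : {mpoly C[m]}) e => (msize p <= e.+1)%N)) => //.
  by rewrite msize1.
by move=> p e q f; apply: msizeM_leq.
Qed.

Lemma msize_vdm m :
  msize (vdm (fun i : 'I_m => 'X_i : {mpoly C[m]})) =
  (\sum_(i < m) \sum_(j < m | (i < j)%N) 1).+1.
Proof.
pose Q (p : {mpoly C[m]}) e := p != 0 /\ msize p = e.+1.
have QM p e q f : Q p e -> Q q f -> Q (p * q) (e + f)%N.
  move=> [p0 pe] [q0 qf]; split; first by rewrite mulf_neq0.
  by rewrite msizeM // pe qf addSn addnS.
have Q1 : Q 1 0%N by split; [exact: oner_neq0|exact: msize1].
suff [] : Q (vdm (fun i : 'I_m => 'X_i : {mpoly C[m]}))
          (\sum_(i < m) \sum_(j < m | (i < j)%N) 1)%N by [].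
rewrite /vdm; apply: (big_ind2 Q) => // i _; apply: (big_ind2 Q) => // j ij.
have n0 : 'X_i - 'X_j != 0 :> {mpoly C[m]}.
  by rewrite subr_eq0; apply: contraTneq ij => /mpolyXI ->; rewrite ltnn.
split=> //; apply/eqP; rewrite eqn_leq; apply/andP; split.
  by apply: msizeD_leq; rewrite ?msizeN msizeX mdeg1.
rewrite ltnNge; apply/negP => /msize1_polyC/(congr1 (mcoeff U_(i))).
rewrite mcoeffB !mcoeffXU mcoeffC eqxx mnm1_eq0 mulr0.
by rewrite (_ : j == i = false) ?subr0; [move/eqP; rewrite oner_eq0|rewrite -val_eqE /= gtn_eqF].
Qed.

Lemma facP_poly_msize a mu m : (msize (facP_poly a mu m) <= (sumn mu).+1)%N.
Proof.
case: (leqP (size mu) m) => lm; last by rewrite facP_poly0 // msize0.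
have [->|p0] := eqVneq (facP_poly a mu m) 0; first by rewrite msize0.
have v0 : vdm (fun i : 'I_m => 'X_i : {mpoly C[m]}) != 0.
  by apply: vdm_neq0 => i j /mpolyXI.
have := congr1 (fun p : {mpoly C[m]} => msize p) (facP_poly_vdm a lm).
rewrite /= msizeM // msize_vdm addnS /=; set n := (\sum_(i < m) _)%N.
suff : (msize ((((m - size mu)`!%:R)^-1)%:MP_[m] *
   facP_num (fun r => (a r)%:MP_[m]) mu (fun i : 'I_m => 'X_i)) <= (sumn mu + n).+1)%N.
  by move=> le e; rewrite -(leq_add2r n) e.
apply: (msizeM_leq (d := 0%N) (e := (sumn mu + n)%N)); first by rewrite msizeC; case: eqP.
rewrite /facP_num; elim/big_ind: _ => [|p q|w _]; first by rewrite msize0.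
  exact: msizeD_leq.
apply: (msizeM_leq (d := 0%N) (e := (sumn mu + n)%N)).
  by rewrite -signr_odd; case: odd; rewrite ?expr1 ?msizeN ?expr0 msize1.
have -> : n = (\sum_(i < m | (i < size mu)%N) \sum_(j < m | (i < j)%N) 1 +
   \sum_(i < m | ~~ (i < size mu)%N) \sum_(j < m | (i < j)%N) 1)%N.
  by rewrite /n (bigID (fun i : 'I_m => (i < size mu)%N)).
rewrite addnA.
have XD (i j : 'I_m) : (msize ('X_i + 'X_j : {mpoly C[m]}) <= 1.+1)%N.
  by apply: msizeD_leq; rewrite msizeX mdeg1.
have XB (i j : 'I_m) : (msize ('X_i - 'X_j : {mpoly C[m]}) <= 1.+1)%N.
  by apply: msizeD_leq; rewrite ?msizeN msizeX mdeg1.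
apply: msizeM_leq; last by do 2!apply: msize_prod_leq => ? _.
apply: msizeM_leq; last by do 2!apply: msize_prod_leq => ? _.
have -> : sumn mu = (\sum_(i < m | (i < size mu)%N) nth 0 mu i)%N.
  by rewrite -(big_ord_widen _ (nth 0%N mu)) // sumnE (big_nth 0%N) big_mkord.
apply: msize_prod_leq => i _; rewrite /shifted_pow.
have {2}-> : nth 0%N mu i = (\sum_(1 <= r < (nth 0 mu i).+1) 1)%N.
  by rewrite sum_nat_const_nat muln1 subn1.
apply: msize_prod_leq => r _; apply: msizeD_leq; first by rewrite msizeX mdeg1.
by rewrite msizeN msizeC; case: eqP.
Qed.

Lemma facP_poly_super a mu m : supersymmetric (facP_poly a mu m).
Proof.
split=> [|i j ij]; first exact: facP_poly_sym.
pose K := {fraction {poly {mpoly C[m]}}}.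
pose tf : {poly {mpoly C[m]}} -> K := @FracField.tofrac _.
pose u (t : {poly {mpoly C[m]}}) (k : 'I_m) : {poly {mpoly C[m]}} :=
  if k == i then t else if k == j then - t else ('X_k)%:P.
pose h := polyC \o @mpolyC m C.
have ji : (j == i) = false by rewrite eq_sym (negbTE ij).
have good (t : {poly {mpoly C[m]}}) : t != 0 -> t != - t ->
  (forall k : 'I_m, ('X_k)%:P != t /\ ('X_k)%:P != - t) -> injective (u t).
  move=> t0 tNt tk k l; rewrite /u.
  have Xk l' := (tk l').1; have XNk l' := (tk l').2.
  case: (eqVneq k i) (eqVneq l i) => [->|ki] [->|li] //.
  - case: (eqVneq l j) => [_ /eqP|_ /eqP]; first by rewrite (negbTE tNt).
    by rewrite eq_sym (negbTE (Xk _)).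
  - case: (eqVneq k j) => [_ /eqP|_ /eqP]; first by rewrite eq_sym (negbTE tNt).
    by rewrite (negbTE (Xk _)).
  case: (eqVneq k j) (eqVneq l j) => [->|kj] [->|lj] //.
  - by move/eqP; rewrite eq_sym (negbTE (XNk _)).
  - by move/eqP; rewrite (negbTE (XNk _)).
  by move/polyC_inj/mpolyXI.
have two0 : (2%:R : {mpoly C[m]}) != 0 by rewrite -mpolyC_nat mpolyC_eq0 pnatr_eq0.
have neN (R : idomainType) (t : R) : 2%:R != 0 :> R -> t != 0 -> t != - t.
  by move=> n2 t0; rewrite -subr_eq0 opprK -mulr2n -mulr_natr mulf_neq0.
have Xne (k : 'I_m) : ('X_k)%:P != 'X :> {poly {mpoly C[m]}} /\ ('X_k)%:P != - 'X :> {poly {mpoly C[m]}}.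
  split; apply/eqP => /(congr1 (fun p : {poly {mpoly C[m]}} => p`_1)) /eqP.
    by rewrite coefC coefX eq_sym oner_eq0.
  by rewrite coefC coefN coefX eq_sym oppr_eq0 oner_eq0.
have X1 (k : 'I_m) : ('X_k)%:P != 1 :> {poly {mpoly C[m]}} /\ ('X_k)%:P != - 1 :> {poly {mpoly C[m]}}.
  split; rewrite -polyC1 -?polyCN (inj_eq (@polyC_inj _)).
    apply/eqP => /(congr1 (mcoeff U_(k))) /eqP.
    by rewrite mcoeffXU mcoeff1 eqxx mnm1_eq0 oner_eq0.
  apply/eqP => /(congr1 (mcoeff U_(k))) /eqP.
  by rewrite mcoeffN mcoeffXU mcoeff1 eqxx mnm1_eq0 oppr0 oner_eq0.
have poly20 : (2%:R : {poly {mpoly C[m]}}) != 0 by rewrite -polyC_natr polyC_eq0.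
have iX : injective (u 'X) by apply: good; rewrite ?polyX_eq0 ?neN ?polyX_eq0.
have i1 : injective (u 1) by apply: good; rewrite ?oner_eq0 ?neN ?oner_eq0.
have tfI : injective tf by move=> p q /eqP; rewrite tofrac_eq => /eqP.
have tfne p q : p != q -> tf p != tf q by move=> pq; apply: contraNneq pq => /tfI ->.
have tfneN p q : p != - q -> tf p != - tf q.
  by move=> pq; apply: contraNneq pq => e; apply/eqP/tfI; rewrite e /tf rmorphN.
have eX : tf (mmap h (u 'X) (facP_poly a mu m)) = tf (mmap h (u 1) (facP_poly a mu m)).
  rewrite /tf !rmorph_mmap !facP_poly_spec; [|exact: inj_comp tfI i1|exact: inj_comp tfI iX].
  apply: (@facP_frac_super _ _ _ _ _ _ i j) => //.
  - by rewrite /u ji !eqxx rmorphN.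
  - by rewrite /u ji !eqxx rmorphN.
  move=> k ki kj; have [x1 x2] := Xne k; have [x3 x4] := X1 k.
  have uk t : u t k = ('X_k)%:P by rewrite /u (negbTE ki) (negbTE kj).
  have ui t : u t i = t by rewrite /u eqxx.
  rewrite !uk !ui.
  by split; [by []|exact: tfne|exact: tfneN|exact: tfne|exact: tfneN].
exists (mmap (@mpolyC m C)
  (fun k => if k == i then 1 else if k == j then - 1 else 'X_k) (facP_poly a mu m)).
rewrite /subst_opp -/h -/(u 'X) (tfI _ _ eX) rmorph_mmap; congr mmap; apply/funext => k.
by rewrite /u; case: ifP => _; [|case: ifP => _]; rewrite /= ?polyCN ?polyC1.
Qed.

Lemma facP_poly_stable a mu m : a 1%N = 0 -> 0%N \notin mu ->
  facP_poly a mu m.+1 \mPo last0 C m = facP_poly a mu m.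
Proof.
move=> a1 mu0; apply/eqP; rewrite -tofrac_eq /comp_mpoly rmorph_mmap facP_polyE.
pose x (i : 'I_m) := FracField.tofrac ('X_i : {mpoly C[m]}).
have x0 i : x i != 0 by rewrite tofrac_eq0; apply/eqP => /(congr1 (mcoeff U_(i)))/eqP;
  rewrite mcoeffXU mcoeff0 eqxx oner_eq0.
have -> : (fun i => FracField.tofrac (tnth (last0 C m) i)) =
   (fun i : 'I_m.+1 => if unlift ord_max i is Some k then x k else 0).
  by apply/funext => i; rewrite tnth_mktuple; case: unlift => // ; rewrite tofrac0.
rewrite facP_poly_spec.
  apply/eqP; apply: facP_frac_stable => //; last by rewrite /= a1 mpolyC0 tofrac0.
  by move=> n; rewrite -(rmorph_nat (@FracField.tofrac {mpoly C[m]})) tofrac_eq0 -mpolyC_nat mpolyC_eq0 pnatr_eq0.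
move=> i j; case: unliftP => [k ->|->]; case: unliftP => [l ->|->] //.
- by move=> /eqP; rewrite tofrac_eq => /eqP/mpolyXI ->.
- by move=> /eqP; rewrite (negbTE (x0 _)).
- by move=> /esym/eqP; rewrite (negbTE (x0 _)).
Qed.

Lemma strict_stable a (mu : strict_part) (a1 : a 1%N = 0) m :
  facP_poly a mu m.+2 \mPo last0 C m.+1 = facP_poly a mu m.+1.
Proof. by apply: facP_poly_stable => //; case/andP: (partsP mu). Qed.

Lemma facP_poly_bounded a mu : exists d, forall m, (msize (facP_poly a mu m.+1) <= d)%N.
Proof. by exists (sumn mu).+1 => m; apply: facP_poly_msize. Qed.

(* P_(mu; a); the hypothesis a_1 = 0 is what makes the sequence stable.  The entry
   a 0 is never used: the parameters are a 1, a 2, etc. *)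
Definition factorialP a (a1 : a 1%N = 0) (mu : strict_part) : Gamma C :=
  MkGamma (fun m => facP_poly_super a mu m.+1) (strict_stable mu a1)
          (facP_poly_bounded a mu).

End FactorialPGamma.

(* Main.v *)
(* In m variables, multiply each summand of P_mu by sum_j x_j - sum_j a_(mu_j + 1).
   For i <= l(mu), the factor x_(w i) - a_(mu_i + 1) turns (x | a)^(mu_i) into
   (x | a)^(mu_i + 1), that is, adds a box to row i.  The remaining variables
   contribute the sum of the x_(w k), k > l(mu), and by partial fractions
     sum_k y_k = sum_k y_k prod_(j != k) (y_k + y_j) / (y_k - y_j),
   whose terms, exchanged by transpositions, all have the same sum over w: this is
   the new row (1), since (x | a)^1 = x when a_1 = 0.  Additions of a box giving two
   equal rows contribute 0 because the summands are then antisymmetric under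
   exchanging these rows. *)
Require Import Defs.
From mathcomp Require Import all_boot all_order all_algebra all_fingroup.
From mathcomp Require Import zify boolp reals complex mpoly.

Set Implicit Arguments.
Unset Strict Implicit.
Unset Printing Implicit Defensive.

Import GRing.Theory Num.Theory.
Local Open Scope ring_scope.

(** * Lagrange interpolation and a partial fraction identity *)

Section Ratio.
Variables (F : fieldType) (I : finType).

Lemma coef_prod_XsubC_card (P : pred I) (y : I -> F) n : #|P| = n.+1 ->
  (\prod_(k | P k) ('X - (y k)%:P))`_n = - \sum_(k | P k) y k.
Proof.
move=> cP; have sz : size [seq y k | k <- enum P] = n.+1 by rewrite size_map -cardE.
have -> : \prod_(k | P k) ('X - (y k)%:P) =
          \prod_(p <- [seq y k | k <- enum P]) ('X - p%:P).
  by rewrite big_map big_enum.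
have /= := coefPn_prod_XsubC (ps := [seq y k | k <- enum P]).
by rewrite sz => -> //; rewrite big_map big_enum.
Qed.

(** [G] equals its Lagrange interpolant at the [n.+1] points [y k]. Each basis numerator [L k] is
    monic of degree [n], so it contributes exactly [c k] to the top coefficient. *)
Lemma lagrange_coef (P : pred I) (y : I -> F) (G : {poly F}) n :
  injective y -> #|P| = n.+1 -> (size G <= n.+1)%N ->
  \sum_(k | P k) G.[y k] / \prod_(j | P j && (j != k)) (y k - y j) = G`_n.
Proof.
move=> yI cP sG.
pose L k := \prod_(j | P j && (j != k)) ('X - (y j)%:P).
pose c k := G.[y k] / \prod_(j | P j && (j != k)) (y k - y j).
have sL k : P k -> size (L k) = n.+1.
  move=> Pk; rewrite /L -big_enum /= size_prod_XsubC -cardE; congr _.+1.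
  apply/eqP; rewrite -eqSS -cP; apply/eqP.
  rewrite (cardD1 k P) (_ : k \in P = true) ?add1n; last exact: Pk.
  congr _.+1.
  by apply: eq_card => j; rewrite !inE andbC.
have GE : G = \sum_(k | P k) c k *: L k.
  apply/eqP; rewrite -subr_eq0; apply/eqP; set H := (X in X = 0).
  (* [H] has size at most [n.+1] and vanishes at [n.+1] distinct points. *)
  apply: (@roots_geq_poly_eq0 _ _ [seq y k | k <- enum P]).
  - apply/allP => z /mapP[k]; rewrite mem_enum => Pk ->.
    rewrite /root /H hornerD hornerN horner_sum (bigD1 k) //= big1 ?addr0.
      rewrite hornerZ /c /L horner_prod -mulrA.
      rewrite [X in _^-1 * X](eq_bigr (fun j => y k - y j)) => [|j _]; last first.
        by rewrite hornerXsubC.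
      rewrite mulVf ?mulr1 ?subrr //; apply/prodf_neq0 => j /andP[_ jk].
      by rewrite subr_eq0 (inj_eq yI) eq_sym.
    move=> j /andP[Pj jk]; rewrite hornerZ /L horner_prod (bigD1 k) /=.
      by rewrite hornerXsubC subrr mul0r mulr0.
    by rewrite eq_sym jk andbT.
  - by rewrite map_inj_uniq ?enum_uniq.
  rewrite size_map -cardE cP.
  apply: leq_trans (size_polyD _ _) _; rewrite size_polyN geq_max sG /=.
  apply: leq_trans (size_sum _ _ _) _; apply/bigmax_leqP => k Pk.
  by rewrite (leq_trans (size_scale_leq _ _)) ?sL.
rewrite [in RHS]GE coef_sum; apply: eq_bigr => k Pk; rewrite coefZ -/(c k).
have : L k \is monic by apply: monic_prod => j _; apply: monicXsubC.
by rewrite monicE lead_coefE sL // => /eqP ->; rewrite mulr1.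
Qed.

(* Interpolate [\prod_j ('X + y j) - \prod_j ('X - y j)] at the points [y k] and
   compare the coefficients of degree [#|P| - 1]. *)
Lemma sum_mul_ratio (P : pred I) (y : I -> F) :
  2%:R != 0 :> F -> injective y ->
  \sum_(k | P k) y k * \prod_(j | P j && (j != k)) ((y k + y j) / (y k - y j)) =
  \sum_(k | P k) y k.
Proof.
move=> n2 yI; case cP : #|P| => [|n].
  by have P0 := card0_eq cP; rewrite !big_pred0.
pose G : {poly F} := \prod_(j | P j) ('X - (- y j)%:P) - \prod_(j | P j) ('X - (y j)%:P).
have mon (z : I -> F) : \prod_(j | P j) ('X - (z j)%:P) \is monic.
  by apply: monic_prod => j _; apply: monicXsubC.
have sz (z : I -> F) : size (\prod_(j | P j) ('X - (z j)%:P)) = n.+2.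
  by rewrite -big_enum /= size_prod_XsubC -cardE cP.
have sG : (size G <= n.+1)%N.
  apply/leq_sizeP => j; rewrite leq_eqVlt => /orP[/eqP <-|nj].
    have := mon (fun k => - y k); have := mon y; rewrite !monicE !lead_coefE !sz /=.
    by rewrite coefB => /eqP -> /eqP ->; rewrite subrr.
  by rewrite coefB !nth_default ?subrr ?sz.
have := lagrange_coef yI cP sG; rewrite coefB !coef_prod_XsubC_card // sumrN !opprK.
rewrite -mulr2n -mulr_natr => e; apply: (mulIf n2); rewrite -{}e mulr_suml.
apply: eq_bigr => k Pk; rewrite prodf_div mulrA mulrAC; congr (_ / _).
(* At [y k] the second product of [G] vanishes, and the factor [j = k] of the first is twice
   [y k]. *)
rewrite /G hornerD hornerN !horner_prod [X in _ - X](bigD1 k) //= hornerXsubC subrr.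
rewrite mul0r subr0 [RHS](bigD1 k) //= hornerXsubC opprK -mulr2n -mulr_natr.
rewrite mulrAC; congr (_ * _); first by rewrite mul1r mulr_natr.
apply: eq_bigr => j _.
by rewrite hornerXsubC opprK.
Qed.

End Ratio.

(** * Adding one box to a strict partition *)

Lemma leq_sumn (s t : seq nat) : (forall i, nth 0 s i <= nth 0 t i)%N -> (sumn s <= sumn t)%N.
Proof.
elim: s t => [|x s IH] [|y t] //= H.
  by have /= := H 0%N; rewrite leqn0 => /eqP ->; apply: (IH [::]) => i;
    have := H i.+1; rewrite !nth_nil.
by apply: leq_add; [exact: (H 0%N)|apply: IH => i; exact: (H i.+1)].
Qed.

Lemma eq_from_leq_sumn (s t : seq nat) : 0%N \notin t -> (size s <= size t)%N ->
  (forall i, nth 0 s i <= nth 0 t i)%N -> sumn t = sumn s -> t = s.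
Proof.
elim: s t => [|x s IH] [|y t] //=.
  by rewrite inE negb_or; case: y.
rewrite inE negb_or => /andP[_ t0] st H e.
have xy := H 0%N; rewrite /= in xy.
have st' : (forall i, nth 0 s i <= nth 0 t i)%N by move=> i; exact: (H i.+1).
by have := leq_sumn st' => le; rewrite (IH t) //; first congr (_ :: _); lia.
Qed.

(** The first position where [s] and [t] differ absorbs the whole excess of one; the tails then have
    equal sums and coincide. The value [j = size s] stands for a new row of length 1. *)
Lemma incr_nth_of_leq (s t : seq nat) : 0%N \notin t -> (size s <= size t)%N ->
  (forall i, nth 0 s i <= nth 0 t i)%N -> sumn t = (sumn s).+1 ->
  exists2 j, (j <= size s)%N & t = incr_nth s j.
Proof.
elim: s t => [|x s IH] [|y t] //=.
  rewrite inE negb_or => /andP[y0 t0] _ _ e; exists 0%N => //=.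
  have -> : t = [::] by apply: eq_from_leq_sumn => //; [move=> i; rewrite nth_nil|move=> /=; lia].
  by congr [:: _]; move: e; case: t t0 => [|z t] /=; rewrite ?inE; lia.
rewrite inE negb_or => /andP[_ t0] st H e.
have xy := H 0%N; rewrite /= in xy.
have st' : (forall i, nth 0 s i <= nth 0 t i)%N by move=> i; exact: (H i.+1).
have le := leq_sumn st'.
have [yx|yx] := eqVneq y x.
  by have [|j js ->] := IH t t0 st st'; [lia|exists j.+1; rewrite ?yx].
exists 0%N => //=; congr (_ :: _); first lia.
by apply: eq_from_leq_sumn => //; lia.
Qed.

(** One extra box keeps the parts positive and can at most close a gap of one between neighbours, so
    strictness fails only through two equal adjacent parts. *)
Lemma incr_nth_not_strict (s : seq nat) j : is_strict s -> (j <= size s)%N ->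
  ~~ is_strict (incr_nth s j) -> exists2 i, (i.+1 < size (incr_nth s j))%N &
     nth 0%N (incr_nth s j) i = nth 0%N (incr_nth s j) i.+1.
Proof.
move=> /andP[/(sortedP 0%N) ss s0] js.
have szE : size (incr_nth s j) = maxn (size s) j.+1.
  by rewrite size_incr_nth /maxn; case: (ltnP j (size s)); case: (ltnP _ j.+1); lia.
have pos i : (i < size (incr_nth s j))%N -> (0 < nth 0 (incr_nth s j) i)%N.
  rewrite szE nth_incr_nth => isz; have [//|ji] := eqVneq j i.
  rewrite lt0n add0n; apply: contraNneq s0 => <-; apply: mem_nth.
  case: (ltngtP i j) ji isz => // ij _; first by move=> _; apply: leq_trans js.
  by rewrite leq_max => /orP[//|]; rewrite ltnS leqNgt ij.
rewrite negb_and negbK => /orP[|/(nthP 0%N)[i isz i0]]; last by have := pos i isz; rewrite i0.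
move=> ns; have ex : exists i, (i.+1 < size (incr_nth s j))%N &&
    (nth 0%N (incr_nth s j) i == nth 0%N (incr_nth s j) i.+1).
  apply: contrapT => H; case/negP: ns; apply/(sortedP 0%N) => i isz /=.
  have ne : nth 0%N (incr_nth s j) i != nth 0%N (incr_nth s j) i.+1.
    by apply/negP => e; apply: H; exists i; rewrite isz.
  have posi := pos i (ltnW isz).
  rewrite szE in isz; rewrite !nth_incr_nth in ne posi *.
  have [lt|le] := ltnP i.+1 (size s).
    rewrite ltn_neqAle (eq_sym (_ + _)%N) ne /=; have /= := ss i lt.
    by case: (j == i); case: (j == i.+1) => /=; lia.
  (* Beyond the old parts, entry [i.+1] is at most 1, hence at most the positive entry [i]. *)
  rewrite ltn_neqAle (eq_sym (_ + _)%N) ne /= [nth 0%N s i.+1]nth_default // addn0.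
  by case: (j == i.+1).
by case: ex => i /andP[? /eqP]; exists i.
Qed.

Lemma sumn_incr_nth (s : seq nat) j : sumn (incr_nth s j) = (sumn s).+1.
Proof.
elim: s j => [|x s IH] [|j] //=; last by rewrite IH addnS.
by rewrite sumn_ncons.
Qed.

(** This indexes the covers of [mu] by the row that receives the box. Both lists are duplicate-free,
    so it suffices to compare their members. *)
Lemma perm_covers (mu : strict_part) :
  perm_eq [seq parts lam | lam <- strict_parts (sumn mu).+1 & covers mu lam]
          [seq s <- [seq incr_nth mu j | j <- iota 0 (size mu).+1] | is_strict s].
Proof.
apply: uniq_perm.
- by rewrite map_inj_uniq ?filter_uniq ?strict_parts_uniq //; apply: val_inj.
- by rewrite filter_uniq ?map_inj_uniq ?iota_uniq //; apply: incr_nth_inj.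
move=> s; apply/mapP/idP => [[lam]|].
  rewrite mem_filter => /andP[/andP[/eqP sl /andP[szl /forallP H]] _] ->.
  rewrite mem_filter partsP /=.
  have [] := @incr_nth_of_leq mu lam => // [||j js ->].
  - by case/andP: (partsP lam).
  - by move=> i; case: (ltnP i (size mu)) => im; [exact: (H (Ordinal im))|rewrite nth_default].
  by rewrite -[_ :: _]/(map (incr_nth mu) (iota 0 (size mu).+1)) map_f // mem_iota.
rewrite mem_filter => /andP[ss /mapP[j]]; rewrite mem_iota => /andP[_ js] e.
exists (StrictPart ss) => //.
have sums : sumn s = (sumn mu).+1 by rewrite e sumn_incr_nth.
rewrite mem_filter mem_strict_parts /= sums eqxx andbT /covers /= sums eqxx /=.
apply/andP; split; first by rewrite /= e size_incr_nth; case: ltnP => //; apply: leqW.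
by apply/forallP => i; rewrite /= e nth_incr_nth leq_addl.
Qed.

(** Rows where the new box breaks strictness may be kept on the right: there two adjacent parts
    agree and [f] vanishes. *)
Lemma sum_covers (V : nmodType) (mu : strict_part) (f : seq nat -> V) :
  (forall s i, (i.+1 < size s)%N -> nth 0%N s i = nth 0%N s i.+1 -> f s = 0) ->
  \sum_(lam <- strict_parts (sumn mu).+1 | covers mu lam) f lam =
  \sum_(j < (size mu).+1) f (incr_nth mu j).
Proof.
move=> f0; rewrite -big_filter -(big_map parts xpredT f).
rewrite (perm_big _ (perm_covers mu)) big_filter big_map.
rewrite big_mkcond -[in RHS](big_mkord xpredT (fun j => f (incr_nth mu j))).
rewrite /index_iota subn0 !big_seq; apply: eq_bigr => j; rewrite mem_iota => /andP[_ js].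
case: ifP => // /negbT ns; have [i i1 i2] := incr_nth_not_strict (partsP mu) js ns.
by rewrite (f0 _ _ i1 i2).
Qed.

(** * The Pieri rule at distinct points of a field *)

Section Pieri.
Variables (F : fieldType) (a : nat -> F) (m : nat) (x : 'I_m -> F).
Hypothesis char0 : forall n, n.+1%:R != 0 :> F.
Hypothesis xI : injective x.
Hypothesis a1 : a 1%N = 0.
Implicit Types (mu : seq nat) (w : 'S_m).

Definition facP_kernel l (y : 'I_m -> F) : F :=
  \prod_(i < m | (i < l)%N) \prod_(j < m | (i < j)%N) ((y i + y j) / (y i - y j)).

Definition shifted_monomial mu (y : 'I_m -> F) : F :=
  \prod_(i < m | (i < size mu)%N) shifted_pow a (y i) (nth 0%N mu i).

Lemma facP_frac_kernel mu : (size mu <= m)%N ->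
  facP_frac a mu x = ((m - size mu)`!%:R)^-1 *
    \sum_(w : 'S_m) shifted_monomial mu (x \o w) * facP_kernel (size mu) (x \o w).
Proof. by rewrite /facP_frac => ->. Qed.

Lemma sum_neg_eq0 (f : 'S_m -> F) (s : 'S_m) :
  (forall w, f (s * w)%g = - f w) -> \sum_(w : 'S_m) f w = 0.
Proof.
move=> fN; have : \sum_(w : 'S_m) f w = - \sum_(w : 'S_m) f w.
  by rewrite {1}(reindex_inj (mulgI s)) -sumrN; apply: eq_bigr.
move/eqP; rewrite -addr_eq0 -mulr2n -mulr_natr mulf_eq0 (negbTE (char0 1)) orbF.
by move/eqP.
Qed.

(** Positions from [l] on occur only as second indices, and every [k < l] is paired with all of
    them, so their order is immaterial. *)
Lemma kernel_tperm l (y : 'I_m -> F) (i j : 'I_m) : (l <= i)%N -> (l <= j)%N ->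
  facP_kernel l (y \o tperm i j) = facP_kernel l y.
Proof.
move=> li lj; apply: eq_bigr => k kl.
have tk : tperm i j k = k.
  by apply: tpermD; rewrite -val_eqE /= gtn_eqF // (leq_trans kl).
rewrite [RHS](reindex_inj (@perm_inj _ (tperm i j))) /=; apply: eq_big => k' /=; last by rewrite tk.
by case: tpermP => [->|->|] //; rewrite !(leq_trans kl).
Qed.

Lemma shifted_monomial_tperm mu (y : 'I_m -> F) (i j : 'I_m) :
  (size mu <= i)%N -> (size mu <= j)%N ->
  shifted_monomial mu (y \o tperm i j) = shifted_monomial mu y.
Proof.
move=> li lj; apply: eq_bigr => k kl /=; rewrite tpermD //.
  by rewrite -val_eqE /= gtn_eqF // (leq_trans kl).
by rewrite -val_eqE /= gtn_eqF // (leq_trans kl).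
Qed.

(** No position lies between [i] and [j], so the exchange permutes the factors of all other pairs;
    only the factor of [(i, j)] changes, by a sign. *)
Lemma kernel_tperm_adj l (y : 'I_m -> F) (i j : 'I_m) : j = i.+1 :> nat -> (j < l)%N ->
  facP_kernel l (y \o tperm i j) = - facP_kernel l y.
Proof.
move=> ji jl; have il : (i < l)%N by rewrite -ltnS -ji ltnW.
have ij : i != j by rewrite -val_eqE /= ji ltn_eqF.
pose t := tperm i j.
pose r (k k' : 'I_m) := (y k + y k') / (y k - y k').
have rN k k' : r k k' = - r k' k by rewrite /r addrC -[y k - y k']opprB invrN mulrN.
have split z : facP_kernel l z = \prod_(p : 'I_m * 'I_m | (p.1 < l)%N && (p.1 < p.2)%N)
    ((z p.1 + z p.2) / (z p.1 - z p.2)) by rewrite /facP_kernel pair_big_dep.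
have ijl : ((i, j).1 < l)%N && ((i, j).1 < (i, j).2)%N by rewrite /= il ji ltnSn.
rewrite !split (bigD1 (i, j) ijl) [in RHS](bigD1 (i, j) ijl) /=.
rewrite tpermL tpermR -/(r j i) -/(r i j) rN mulNr; congr (- (_ * _)).
pose tt (p : 'I_m * 'I_m) := (t p.1, t p.2).
have ttI : injective tt by move=> [p q] [p' q'] [/perm_inj -> /perm_inj ->].
rewrite [RHS](reindex_inj ttI) /=; apply: eq_bigl => -[p q] /=.
rewrite !xpair_eqE /t.
rewrite -!val_eqE /=.
case: tpermP => [->|->|/eqP + /eqP +]; case: tpermP => [->|->|/eqP + /eqP +];
  rewrite -?val_eqE /= ?ji; lia.
Qed.

(* Exchanging the variables of two equal adjacent parts fixes the monomial and changes
   the sign of the kernel. *)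
Lemma facP_frac_adj_eq0 mu i : (i.+1 < size mu)%N -> nth 0%N mu i = nth 0%N mu i.+1 ->
  facP_frac a mu x = 0.
Proof.
move=> imu e; case: (leqP (size mu) m) => lm; last by rewrite /facP_frac leqNgt lm.
rewrite facP_frac_kernel //.
have jm : (i.+1 < m)%N by apply: leq_trans lm.
pose i' := Ordinal (ltnW jm); pose j' := Ordinal jm.
rewrite (@sum_neg_eq0 _ (tperm i' j')) ?mulr0 // => w.
have E : x \o (tperm i' j' * w)%g = (x \o w) \o tperm i' j'.
  by apply/funext => k; rewrite /= permM.
rewrite E kernel_tperm_adj // mulrN; congr (- (_ * _)).
rewrite /shifted_monomial [RHS](reindex_inj (@perm_inj _ (tperm i' j'))) /=.
apply: eq_big => k /=; case: tpermP => [->|->|] //=; rewrite ?imu ?(ltnW imu) ?e //.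
Qed.

Lemma incr_nth_size mu : incr_nth mu (size mu) = rcons mu 1%N.
Proof. by elim: mu => //= ? ? ->. Qed.

(** The number of rows stays the same, so only the power in row [j] changes, by one more linear
    factor. [insub] reads [j] as a position in ['I_m], valid because [j < size mu <= m]. *)
Lemma facP_frac_incr mu j : (size mu <= m)%N -> (j < size mu)%N ->
  facP_frac a (incr_nth mu j) x = ((m - size mu)`!%:R)^-1 *
   \sum_(w : 'S_m) shifted_monomial mu (x \o w) * facP_kernel (size mu) (x \o w) *
     ((if insub j is Some i then x (w i) else 0) - a (nth 0%N mu j).+1).
Proof.
move=> lm jl; have sE : size (incr_nth mu j) = size mu by rewrite size_incr_nth jl.
have jm := leq_trans jl lm.
rewrite facP_frac_kernel sE //; congr (_ * _); apply: eq_bigr => w _.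
rewrite mulrAC; congr (_ * _); rewrite insubT /shifted_monomial sE.
rewrite (bigD1 (Ordinal jm)) //= [in RHS](bigD1 (Ordinal jm)) //= mulrAC.
congr (_ * _).
  by rewrite nth_incr_nth eqxx /= /shifted_pow big_nat_recr.
apply: eq_bigr => k /andP[_]; rewrite -val_eqE /= => kj.
by rewrite nth_incr_nth eq_sym (negbTE kj).
Qed.

(** The new row is averaged over all [m - l] positions from [l] on, which give equal sums over [w];
    this count accounts for the ratio of [(m - l)!] to [(m - l.+1)!]. Then [sum_mul_ratio] evaluates
    the sum over positions. *)
Lemma facP_frac_rcons mu : (size mu <= m)%N ->
  facP_frac a (rcons mu 1%N) x = ((m - size mu)`!%:R)^-1 *
   \sum_(w : 'S_m) shifted_monomial mu (x \o w) * facP_kernel (size mu) (x \o w) *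
     \sum_(k < m | (size mu <= k)%N) x (w k).
Proof.
set l := size mu => lm.
have sE : size (rcons mu 1%N) = l.+1 by rewrite size_rcons.
(* For [l = m] the left side has too many parts, and the sum over [k] on the right is empty. *)
have [lm'|ml] := ltnP l m; last first.
  rewrite /facP_frac sE ltnNge ml /= big1 ?mulr0 // => w _.
  rewrite big_pred0 ?mulr0 // => k; rewrite leqNgt (leq_trans _ ml) //.
rewrite facP_frac_kernel sE //.
pose i0 := Ordinal lm'.
(* [R k] is the contribution of the new row when position [k] plays its role; the actual one is
   [i0]. *)
pose R (k : 'I_m) (y : 'I_m -> F) :=
  y k * \prod_(j < m | (l <= j)%N && (j != k)) ((y k + y j) / (y k - y j)).
pose f (k : 'I_m) (w : 'S_m) :=
  shifted_monomial mu (x \o w) * facP_kernel l (x \o w) * R k (x \o w).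
have f0 w : shifted_monomial (rcons mu 1%N) (x \o w) * facP_kernel l.+1 (x \o w) = f i0 w.
  rewrite /f /R; set y := x \o w.
  have -> : shifted_monomial (rcons mu 1%N) y = shifted_monomial mu y * y i0.
    rewrite /shifted_monomial sE (bigD1 i0) //= nth_rcons ltnn eqxx.
    rewrite {1}/shifted_pow big_nat1 a1 subr0 mulrC; congr (_ * _).
    apply: eq_big => [k|k /andP[kl ki]]; first by rewrite -val_eqE /= ltnS ltn_neqAle andbC.
    by move: kl ki; rewrite nth_rcons -val_eqE /= ltnS leq_eqVlt => /orP[->//|-> _].
  have -> : facP_kernel l.+1 y = facP_kernel l y *
      \prod_(j < m | (l <= j)%N && (j != i0)) ((y i0 + y j) / (y i0 - y j)).
    rewrite /facP_kernel (bigD1 i0) //= mulrC; congr (_ * _).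
      by apply: eq_bigl => k; rewrite -val_eqE /= ltnS ltn_neqAle andbC.
    by apply: eq_bigl => k; rewrite -val_eqE /= ltn_neqAle eq_sym andbC.
  by rewrite mulrACA.
have fk (k : 'I_m) : (l <= k)%N -> \sum_(w : 'S_m) f k w = \sum_(w : 'S_m) f i0 w.
  move=> lk; rewrite [RHS](reindex_inj (mulgI (tperm i0 k))); apply: eq_bigr => w _.
  have E : x \o (tperm i0 k * w)%g = (x \o w) \o tperm i0 k.
    by apply/funext => j; rewrite /= permM.
  rewrite /f E shifted_monomial_tperm // kernel_tperm //; congr (_ * _).
  rewrite /R /= tpermL; congr (_ * _).
  rewrite [LHS](reindex_inj (@perm_inj _ (tperm i0 k))) /=; apply: eq_bigl => j.
  by rewrite -{3}[k](tpermL i0) (inj_eq perm_inj); case: tpermP => [->|->|] //=; rewrite leqnn lk.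
have fS w : shifted_monomial mu (x \o w) * facP_kernel l (x \o w) *
     \sum_(k < m | (l <= k)%N) x (w k) = \sum_(k < m | (l <= k)%N) f k w.
  rewrite -mulr_sumr; congr (_ * _); symmetry.
  apply: (@sum_mul_ratio _ _ (fun k : 'I_m => (l <= k)%N) (x \o w)); first exact: char0 1%N.
  exact: inj_comp xI perm_inj.
rewrite (eq_bigr _ (fun w _ => f0 w)) [in RHS](eq_bigr _ (fun w _ => fS w)).
rewrite exchange_big /= (eq_bigr _ fk) sumr_const.
have -> : #|[pred k : 'I_m | (l <= k)%N]| = (m - l.+1).+1.
  rewrite -sum1_card -(big_geq_mkord _ _ xpredT (fun=> 1%N)) sum_nat_const_nat muln1.
  by rewrite subnSK.
rewrite -[in RHS](subnSK lm') factS natrM invfM -[X in _ = _ * X]mulr_natl.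
by rewrite mulrACA mulVf ?mul1r.
Qed.

(** After the two preceding lemmas all terms share one prefactor and, for each [w], one monomial
    times kernel; what remains is linear in the [x (w k)] and the parameters. *)
Lemma facP_frac_pieri mu :
  facP_frac a mu x * (\sum_i x i - \sum_(j < size mu) a (nth 0%N mu j).+1) =
  \sum_(j < (size mu).+1) facP_frac a (incr_nth mu j) x.
Proof.
have [lm|ml] := leqP (size mu) m; last first.
  rewrite {1}/facP_frac leqNgt ml mul0r big1 // => j _.
  have mlj : (m < size (incr_nth mu j))%N.
    by rewrite size_incr_nth; case: (ltnP j) => // /leqW; apply: (leq_trans ml).
  by rewrite /facP_frac leqNgt mlj.
rewrite big_ord_recr /= incr_nth_size facP_frac_rcons //.
rewrite (eq_bigr _ (fun (j : 'I_(size mu)) _ => facP_frac_incr lm (ltn_ord j))).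
rewrite -mulr_sumr exchange_big /= -mulrDr -big_split /= facP_frac_kernel // -mulrA.
congr (_ * _); rewrite mulr_suml; apply: eq_bigr => w _.
rewrite -mulr_sumr -mulrDr; congr (_ * _).
rewrite sumrB [LHS]addrC [RHS]addrAC [RHS]addrC; congr (_ + _).
(* The sum of all variables is unchanged by [w]; it splits into the share of the existing rows and
   that of the new row. *)
rewrite (reindex_inj (@perm_inj _ w)) /= (bigID (fun k : 'I_m => (k < size mu)%N)) /=.
congr (_ + _); last by apply: eq_bigl => k; rewrite -leqNgt.
rewrite (big_ord_widen_cond m xpredT (fun j => if insub j is Some i then x (w i) else 0)) //.
by apply: eq_bigr => k _; rewrite valK.
Qed.

End Pieri.

(** * From field identities to the algebra [Gamma] *)

Theorem theorem6p2 (R : realType) (a : nat -> R[i]) (a1 : a 1%N = 0) (mu : strict_part) :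
  factorialP a1 mu *
    (gamma_p1 R[i] - (\sum_(j < size mu) a (nth 0%N mu j).+1)%:A) =
  \sum_(lam <- strict_parts (sumn mu).+1 | covers mu lam) factorialP a1 lam.
Proof.
apply: GammaP => m; rewrite gammaM gammaD gammaN gammaZ gamma1 gamma_sum /=.
(* [tofrac] is injective, so components are compared in the fraction field, where the variables are
   distinct points and [facP_poly] becomes the explicit sum. *)
apply/eqP; rewrite -tofrac_eq rmorphM rmorphB rmorph_sum /= !facP_polyE; apply/eqP.
rewrite -mul_mpolyC mulr1 !rmorph_sum /=.
pose tf := @FracField.tofrac {mpoly R[i][m.+1]}.
have XI : injective (fun i : 'I_m.+1 => tf 'X_i).
  by move=> i j /eqP; rewrite tofrac_eq => /eqP/mpolyXI.
have char0 n : n.+1%:R != 0 :> {fraction {mpoly R[i][m.+1]}}.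
  by rewrite -(rmorph_nat tf) tofrac_eq0 -mpolyC_nat mpolyC_eq0 pnatr_eq0.
have a1' : tf (a 1%N)%:MP = 0 by rewrite a1 mpolyC0 /tf rmorph0.
under [in RHS]eq_bigr => lam _ do rewrite facP_polyE.
rewrite (@sum_covers _ mu (fun s => facP_rat a s m.+1)); last first.
  by move=> s i si e; apply: facP_frac_adj_eq0 si e.
by rewrite -(facP_frac_pieri char0 XI a1').
Qed.
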